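(* Let $d,k\ge1$ and let $\lambda_j^{(1)},\lambda_j^{(2)}$, $1\le j\le k$, be positive constants. Let $\{M_1(A),\ A\in\mathcal{A}_d\}\sim GPRF\{\lambda_j^{(1)}\}_{1\le j\le k}$ and $\{M_2(A),\ A\in\mathcal{A}_d\}\sim GPRF\{\lambda_j^{(2)}\}_{1\le j\le k}$ be independent generalized Poisson random fields, and let $\mathcal{S}(A)=M_1(A)-M_2(A)$, $A\in\mathcal{A}_d$. Then for all $n\in\mathbb{Z}$ and $A\in\mathcal{A}_d$, $$\Pr\{\mathcal{S}(A)=n\}=e^{-(\Lambda^{(1)}+\Lambda^{(2)})|A|}\sum_{(n_1,\dots,n_k)\in\tilde\Theta(k,n)}\ \prod_{j=1}^{k}\left(\frac{\lambda_j^{(1)}}{\lambda_j^{(2)}}\right)^{n_j/2}I_{|n_j|}\left(2|A|\sqrt{\lambda_j^{(1)}\lambda_j^{(2)}}\right),$$ where $\Lambda^{(i)}=\lambda_1^{(i)}+\dots+\lambda_k^{(i)}$ for $i=1,2$ and $\tilde\Theta(k,n)=\{(n_1,\dots,n_k)\in\mathbb{Z}^k:n_1+2n_2+\dots+kn_k=n\}$.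
   Context: $\mathbb{R}_+=[0,\infty)$, and $\mathcal{A}_d$ is the collection of bounded axis-parallel rectangles (products of $d$ bounded intervals) in $\mathbb{R}^d_+$; $|A|$ is the Lebesgue measure of $A$. Generalized Poisson random field $GPRF\{\lambda_j\}_{1\le j\le k}$ (with $\lambda_1,\dots,\lambda_k>0$): a non-negative integer valued random measure $\{M(A),\ A\in\mathcal{A}_d\}$ on $\mathbb{R}^d_+$ such that for each $A\in\mathcal{A}_d$ $$\Pr\{M(A)=n\}=\sum_{(n_1,\dots,n_k)\in\Theta(k,n)}\ \prod_{j=1}^{k}\frac{(\lambda_j|A|)^{n_j}}{n_j!}e^{-\lambda_j|A|},\quad n\ge0,$$ where $\Theta(k,n)=\{(n_1,\dots,n_k)\in\mathbb{N}_0^k:\sum_{j=1}^k jn_j=n\}$, and $M(A_1),\dots,M(A_m)$ are independent for any disjoint $A_1,\dots,A_m\in\mathcal{A}_d$. $I_\nu$ is the modified Bessel function of the first kind, $I_\nu(x)=\sum_{m=0}^\infty\frac{(x/2)^{2m+\nu}}{m!\,\Gamma(m+\nu+1)}$. *)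

(* Defs.v *)
From HB Require Import structures.
From mathcomp Require Import all_boot all_order all_algebra.
From mathcomp Require Import all_classical all_reals all_analysis.

Set Implicit Arguments.
Unset Strict Implicit.
Unset Printing Implicit Defensive.

Import Order.TTheory GRing.Theory Num.Theory.
Import numFieldNormedType.Exports.

Local Open Scope classical_set_scope.
Local Open Scope ring_scope.

(* Lebesgue measure on R^d, as the iterated product of the one-dimensional
   one; R^0 is a point of mass 1. *)
Fixpoint lebesgue_tuple (R : realType) (d : nat) : set (d.-tuple R) -> \bar R :=
  match d return set (d.-tuple R) -> \bar R with
  | 0 => \d_([tuple])
  | d'.+1 => fun A =>
      (@lebesgue_measure R \x @lebesgue_tuple R d')%E
        [set p : R * d'.-tuple R | A (cons_tuple p.1 p.2)]
  end.

Definition volume (R : realType) (d : nat) (A : set (d.-tuple R)) : R :=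
  fine (lebesgue_tuple A).

(* The endpoints of each side may be included or not, so degenerate and empty
   rectangles are allowed. *)
Definition rectangle (R : realType) (d : nat) : set (set (d.-tuple R)) :=
  [set A | exists2 I : 'I_d -> interval R,
     (forall i, bounded_set [set` I i] /\ [set` I i] `<=` `[0, +oo[) &
     A = [set x | forall i, tnth x i \in I i]].

(* A family (M A) of nat-valued random variables is given on all subsets of
   R^d, but only its values on rectangles are ever constrained or used. *)
Definition random_measure (disp : measure_display) (T : measurableType disp)
    (R : realType) (P : probability T R) (d : nat)
    (M : set (d.-tuple R) -> {RV P >-> nat}) : Prop :=
  forall w : T, exists mu : {measure set (d.-tuple R) -> \bar R},
    forall A, rectangle A -> mu A = (M A w)%:R%:E.

(* Since the B i may be setT, the product rule for the full family entails the
   one for every subfamily. *)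
Definition mutually_independent (disp disp' : measure_display)
    (T : measurableType disp) (T' : measurableType disp') (R : realType)
    (P : probability T R) (m : nat) (X : 'I_m -> {RV P >-> T'}) : Prop :=
  forall B : 'I_m -> set T', (forall i, measurable (B i)) ->
    P (\bigcap_i (X i @^-1` B i)) = (\prod_(i < m) P (X i @^-1` B i))%E.

Definition Theta (k n : nat) : set {ffun 'I_k -> nat} :=
  [set v | (\sum_(j < k) j.+1 * v j)%N = n].

(* Indices in 'I_k start at 0: lambda j is the rate of jumps of size j.+1.
   The sum over the finite set Theta k n has nonnegative terms. *)
Definition GPRF (disp : measure_display) (T : measurableType disp)
    (R : realType) (P : probability T R) (d k : nat) (lambda : 'I_k -> R)
    (M : set (d.-tuple R) -> {RV P >-> nat}) : Prop :=
  [/\ random_measure M,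
      (forall A, rectangle A -> forall n : nat,
         P (M A @^-1` [set n]) =
         \esum_(v in @Theta k n)
           (\prod_(j < k) ((lambda j * volume A) ^+ v j / (v j)`!%:R
                           * expR (- (lambda j * volume A))))%:E) &
      (forall (m : nat) (A : 'I_m -> set (d.-tuple R)),
         (forall i, rectangle (A i)) -> trivIset setT A ->
         mutually_independent (fun i => M (A i)))].

Definition sigma_field (disp : measure_display) (T : measurableType disp)
    (R : realType) (P : probability T R) (d : nat)
    (M : set (d.-tuple R) -> {RV P >-> nat}) : set (set T) :=
  <<s \bigcup_(A in @rectangle R d)
        preimage_set_system setT (M A) measurable >>.

Definition independent_fields (disp : measure_display)
    (T : measurableType disp) (R : realType) (P : probability T R) (d : nat)
    (M1 M2 : set (d.-tuple R) -> {RV P >-> nat}) : Prop :=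
  forall E F, sigma_field M1 E -> sigma_field M2 F ->
    P (E `&` F) = (P E * P F)%E.

(* Euler's integral, which is the Gamma function only for 0 < s. *)
Definition Gamma (R : realType) (s : R) : R :=
  \int[@lebesgue_measure R]_(t in `]0, +oo[) (t `^ (s - 1) * expR (- t)).

(* For 0 <= nu and 0 <= x, so that Gamma and `^ are used in their domain;
   0 `^ 0 = 1. *)
Definition besselI (R : realType) (nu x : R) : R :=
  limn (series (fun m : nat =>
    (x / 2) `^ ((2 * m)%:R + nu) / (m`!%:R * Gamma (m%:R + nu + 1)))).

Definition ThetaZ (k : nat) (n : int) : set {ffun 'I_k -> int} :=
  [set v | \sum_(j < k) j.+1%:Z * v j = n].

(* Main.v *)
Require Import Defs.
From HB Require Import structures.
From mathcomp Require Import all_boot all_order all_algebra.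
From mathcomp Require Import all_classical all_reals all_analysis.
From mathcomp Require Import measurable_realfun ring zify.

Set Implicit Arguments.
Unset Strict Implicit.
Unset Printing Implicit Defensive.

Import Order.TTheory GRing.Theory Num.Theory.
Import numFieldNormedType.Exports.

Local Open Scope classical_set_scope.
Local Open Scope ring_scope.

(** Grouping the counts by jump size, [M1 A] and [M2 A] are distributed as
    [\sum_j j N1_j] and [\sum_j j N2_j] with [N1_j], [N2_j] independent Poisson
    variables of means [lambda1 j * |A|] and [lambda2 j * |A|].  Summing the
    joint law over all tables [(N1_j, N2_j)_j] first with the differences
    [v j = N1_j - N2_j] fixed, the sum factorizes over [j], and each factor is
    the Skellam law of [N1_j - N2_j], whose series is the one of the Bessel
    function [I_|v j|].  All terms are nonnegative, so the rearrangements hold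
    in [\bar R] without summability conditions. *)

(** * Sums of nonnegative extended reals over arbitrary index sets *)

Section esum_complements.
Context {R : realType}.
Local Open Scope ereal_scope.

(** Bounding finite partial sums gives one inequality. For finite [c > 0] the other is that same
    inequality for [c^-1] and the family [c * f i]. For infinite [c], either [f] vanishes on [D] or
    a single term already makes the left side infinite. *)
Lemma ge0_esumZl (I : choiceType) (D : set I) (c : \bar R) (f : I -> \bar R) :
  0 <= c -> (forall i, 0 <= f i) ->
  \esum_(i in D) (c * f i) = c * \esum_(i in D) f i.
Proof.
move=> c0 f0.
have esumZ_le (b : \bar R) (g : I -> \bar R) : 0 <= b -> (forall i, 0 <= g i) ->
    \esum_(i in D) (b * g i) <= b * \esum_(i in D) g i.
  move=> b0 g0; apply: ge_ereal_sup => _ [X [finX XD]] <-.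
  rewrite -ge0_mule_fsumr//; apply: lee_wpmul2l => //.
  by apply: esum_ge; exists X.
apply/eqP; rewrite eq_le esumZ_le//=.
have cf0 i : 0 <= c * f i by rewrite mule_ge0.
move: c c0 cf0 => [c||]// c0 cf0.
- have [->|cn0] := eqVneq c 0%R; first by
    rewrite mul0e esum_ge0// => i _; rewrite mul0e.
  have cp : (0 < c)%R by rewrite lt_def cn0 -lee_fin.
  rewrite -[X in _ * X](_ : \esum_(i in D) (c^-1%:E * (c%:E * f i)) = _); last first.
    by apply: eq_esum => i _; rewrite muleA -EFinM mulVf// mul1e.
  apply: (le_trans (lee_wpmul2l c0 (esumZ_le c^-1%:E _ _ _))) => //.
    by rewrite lee_fin invr_ge0 ltW.
  by rewrite muleA -EFinM mulfV// mul1e.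
- have [fD0|/existsNP[i /not_implyP[Di /eqP fi0]]] :=
    pselect (forall i, D i -> f i = 0).
    by rewrite (esum1 fD0) mule0 esum_ge0.
  rewrite (le_trans (leey _))//; apply: esum_ge; exists [set i].
    by split => // _ ->.
  by rewrite fsbig_set1 gt0_mulye// lt_def fi0 f0.
Qed.

Lemma ge0_esumM (I J : choiceType) (A : set I) (B : set J)
    (f : I -> \bar R) (g : J -> \bar R) :
  (forall i, 0 <= f i) -> (forall j, 0 <= g j) ->
  (\esum_(i in A) f i) * (\esum_(j in B) g j) =
  \esum_(p in A `*` B) (f p.1 * g p.2).
Proof.
move=> f0 g0.
transitivity (\esum_(i in A) \esum_(j in B) (f i * g j)).
  rewrite muleC -ge0_esumZl//; last exact: esum_ge0.
  by apply: eq_esum => i _; rewrite muleC ge0_esumZl.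
by rewrite esum_esum// => i j _ _; exact: mule_ge0.
Qed.

Lemma ge0_esum_preimage (I J : choiceType) (h : I -> J) (B : set J)
    (f : I -> \bar R) : (forall i, 0 <= f i) ->
  \esum_(i in h @^-1` B) f i = \esum_(j in B) \esum_(i in h @^-1` [set j]) f i.
Proof.
(* The double sum runs over the pairs [(h i, i)], the graph of [h] above [B]. *)
move=> f0; rewrite esum_esum//; symmetry.
apply: (@reindex_esum R I (J * I)%type _ _ (fun i => (h i, i)) (fun p => f p.2)).
split=> [i Bi //|i i' _ _ [_ ->]//|[j i] [/= Bj hij]].
by exists i; rewrite /= hij.
Qed.

(** Distributivity, by induction on [k]: a table on ['I_k.+1] amounts to its entry at [ord0] and a
    table on the lifted indices, glued by [e] below. *)
Lemma prod_esum (S : choiceType) (k : nat) (D : 'I_k -> set S)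
    (f : 'I_k -> S -> \bar R) : (forall j s, 0 <= f j s) ->
  \prod_(j < k) (\esum_(s in D j) f j s) =
  \esum_(u in [set u : {ffun 'I_k -> S} | forall j, D j (u j)])
    \prod_(j < k) f j (u j).
Proof.
elim: k D f => [|k ih] D f f0.
  pose z : {ffun 'I_0 -> S} := ffun0 (card_ord 0).
  have u0 (u : {ffun 'I_0 -> S}) : u = z by apply/ffunP => -[].
  rewrite big_ord0 (_ : [set _ | _] = [set z]); last first.
    by apply/seteqP; split => [u _ /=|u _ []//]; rewrite (u0 u).
  by rewrite esum_set1 big_ord0.
rewrite big_ord_recl ih// ge0_esumM//; last by move=> u; exact: prode_ge0.
pose e (p : S * {ffun 'I_k -> S}) : {ffun 'I_k.+1 -> S} :=
  [ffun i => if unlift ord0 i is Some j then p.2 j else p.1].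
have e0 p : e p ord0 = p.1 by rewrite ffunE unlift_none.
have eS p j : e p (lift ord0 j) = p.2 j by rewrite ffunE liftK.
rewrite (@reindex_esum _ _ _
    (D ord0 `*` [set u : {ffun 'I_k -> S} | forall j, D (lift ord0 j) (u j)]) _ e).
  apply: eq_esum => p _; rewrite big_ord_recl e0; congr (_ * _).
  by apply: eq_bigr => j _; rewrite eS.
split.
- move=> p [/= p1 p2] j; case: (unliftP ord0 j) => [i ->|->]; last by rewrite e0.
  by rewrite eS.
- move=> p q _ _ epq; rewrite [p]surjective_pairing [q]surjective_pairing.
  rewrite -!e0 epq; congr pair.
  by apply/ffunP => j; rewrite -!eS epq.
- move=> u /= Du; exists (u ord0, [ffun j => u (lift ord0 j)]).
    by split => //= j; rewrite ffunE.
  apply/ffunP => i; rewrite ffunE.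
  by case: unliftP => [j ->|->] //=; rewrite ffunE.
Qed.

Lemma measure_preimage_esum (disp : measure_display) (T : measurableType disp)
    (mu : {measure set T -> \bar R}) (I : countType) (X : T -> I) (D : set I) :
  (forall i, measurable (X @^-1` [set i])) ->
  mu (X @^-1` D) = \esum_(i in D) mu (X @^-1` [set i]).
Proof.
(* The injective coding [pickle] turns the fibres of [X] into a disjoint sequence, to which
   countable additivity applies. *)
move=> mX; pose a (j : nat) := mu [set w | pickle (X w) = j].
transitivity (\esum_(j in pickle @` D) a j); last first.
  rewrite esum_image; last by move=> i j _ _; exact: (pcan_inj pickleK).
  apply: eq_esum => i _; congr (mu _).
  by apply/seteqP; split => [w /= /(pcan_inj pickleK)|w /= ->].
rewrite -[X in esum X](set_mem_set (pickle @` D)) -nneseries_esum//.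
rewrite -(measure_bigcup mu (pickle @` D) (fun j => [set w | pickle (X w) = j])).
- congr (mu _); apply/seteqP; split => [w Dw|w [_ [i Di <-]] /=].
    by exists (pickle (X w)) => //; exists (X w).
  by move/(pcan_inj pickleK) => ->.
- move=> _ [i _ <-]; rewrite (_ : [set _ | _] = X @^-1` [set i])//.
  by apply/seteqP; split => [w /= /(pcan_inj pickleK)|w /= ->].
- by apply/trivIsetP => i j _ _ ij; apply/seteqP; split => // w [/= -> /eqP];
    rewrite (negPf ij).
Qed.

End esum_complements.

(** * The Gamma function at positive integers *)

Section Gamma_nat.
Context {R : realType}.

Lemma cvgy_invr : x^-1 @[x --> +oo] --> (0 : R).
Proof.
apply/cvgrVy; first by near=> x; rewrite invr_gt0; near: x; exact: nbhs_pinfty_gt.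
have -> : unstable.inv_fun (fun x : R => x^-1) = id by apply/funext => x; exact: invrK.
exact: cvg_id.
Unshelve. all: by end_near. Qed.

(** The recursion is integration by parts; in closed form this is [- n! * exp(-t)] times the sum of
    [t^i / i!] over [i <= n]. *)
Fixpoint Gamma_primitive (n : nat) (t : R) : R :=
  if n is m.+1 then m.+1%:R * Gamma_primitive m t - t ^+ m.+1 * expR (- t)
  else - expR (- t).

Lemma is_derive_Gamma_primitive (n : nat) (t : R) :
  is_derive t 1 (Gamma_primitive n) (t ^+ n * expR (- t)).
Proof.
elim: n => [|n ih] /=.
  by apply: is_derive_eq; rewrite /GRing.scale/= expr0; ring.
have dX : is_derive t 1 (fun x : R => x ^+ n.+1) (n.+1%:R * t ^+ n).
  have -> : (fun x : R => x ^+ n.+1) = id ^+ n.+1 by apply/funext => x; rewrite exprfctE.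
  by apply: is_derive_eq; rewrite /GRing.scale/= mulr1.
have dE : is_derive t 1 (fun x : R => expR (- x)) (- expR (- t)).
  by apply: is_derive_eq; rewrite /GRing.scale/=; ring.
apply: is_derive_eq (is_deriveB (is_deriveZ n.+1%:R ih) (is_deriveM dX dE)) _.
by rewrite /GRing.scale/=; ring.
Qed.

(** Since [exp(x) >= 1 + x^(n+1) / (n+1)!] for [x >= 0], the function is squeezed between 0 and
    [(n+1)! / x]. *)
Lemma cvgy_exprMexpRN (n : nat) : x ^+ n * expR (- x) @[x --> +oo] --> (0 : R).
Proof.
have xV : ((n.+1)`!%:R * x^-1 : R) @[x --> +oo] --> (0 : R).
  rewrite -[X in _ --> X](mulr0 (n.+1)`!%:R); apply: cvgMr.
  exact: cvgy_invr.
apply: (@squeeze_cvgr _ _ _ _ (cst 0) _ _ _ _ _ xV); last exact: cvg_cst.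
near=> x.
have x0 : 0 < x by near: x; exact: nbhs_pinfty_gt.
rewrite mulr_ge0 ?exprn_ge0 ?expR_ge0 ?(ltW x0)//= expRN ler_pdivrMr ?expR_gt0//.
apply: le_trans (ler_wpM2l _ (expR_ge1Dxn n (ltW x0))); last first.
  by rewrite mulr_ge0// invr_ge0 ltW.
rewrite mulrDr -[leLHS]add0r lerD ?mulr1 ?mulr_ge0 ?invr_ge0 ?(ltW x0)//.
rewrite le_eqVlt; apply/orP; left; apply/eqP.
by rewrite exprS; field; rewrite !gt_eqF// ltr0n fact_gt0.
Unshelve. all: by end_near. Qed.

Lemma cvgy_Gamma_primitive (n : nat) : Gamma_primitive n x @[x --> +oo] --> (0 : R).
Proof.
elim: n => [|n ih] /=.
  by rewrite -[X in _ --> X]oppr0; apply: cvgN; exact: cvgr_expR.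
rewrite -[X in _ --> X](subrr 0) -[X in _ --> X - _](mulr0 n.+1%:R).
by apply: cvgB; [exact: cvgMr|exact: cvgy_exprMexpRN].
Qed.

Lemma Gamma_primitive0 (n : nat) : Gamma_primitive n 0 = - n`!%:R.
Proof.
elim: n => [|n ih] /=; first by rewrite oppr0 expR0.
by rewrite ih expr0n/= mul0r subr0 factS natrM mulrN.
Qed.

Lemma Gamma_nat (n : nat) : Gamma (n%:R + 1) = n`!%:R :> R.
Proof.
have cf : continuous (fun t : R => t ^+ n * expR (- t)).
  move=> x; apply: cvgM; first exact: exprn_continuous.
  by apply: continuous_comp; [exact: opp_continuous|exact: continuous_expR].
have dF x : derivable (Gamma_primitive n) x 1 by have [] := is_derive_Gamma_primitive n x.
rewrite /Gamma /Rintegral addrK.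
under eq_integral.
  move=> x; rewrite inE/= in_itv/= andbT => /ltW x0; rewrite powR_mulrn//.
  over.
(* Adding the null endpoint 0 puts the integral in the form required by the fundamental theorem of
   calculus on a closed half-line. *)
rewrite integral_itv_obnd_cbnd; last first.
  apply/measurable_EFinP; apply: measurable_funTS.
  exact: continuous_measurable_fun.
rewrite (@ge0_continuous_FTC2y _ _ (Gamma_primitive n) _ 0).
- by rewrite -EFinB /= Gamma_primitive0 sub0r opprK.
- by move=> x x0; rewrite mulr_ge0 ?exprn_ge0 ?expR_ge0.
- exact: continuous_subspaceT.
- exact: cvgy_Gamma_primitive.
- by move=> x _.
- apply: cvg_at_right_filter.
  by apply: differentiable_continuous; exact/derivable1_diffP/dF.
- by move=> x _; rewrite derive1E; have [] := is_derive_Gamma_primitive n x.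
Qed.

End Gamma_nat.

(** * Bessel series of integer order and the Skellam law *)

Section besselI_nat.
Context {R : realType}.

Lemma besselI_nat (N : nat) (y : R) : 0 <= y ->
  (besselI N%:R y)%:E = \esum_(m in [set: nat])
    ((y / 2) ^+ (2 * m + N) / (m`!%:R * (m + N)`!%:R))%:E.
Proof.
move=> y0; have y20 : 0 <= y / 2 by rewrite divr_ge0.
pose u (m : nat) := (y / 2) ^+ (2 * m + N) / (m`!%:R * (m + N)`!%:R) : R.
have u0 m : 0 <= u m by rewrite divr_ge0 ?mulr_ge0 ?exprn_ge0.
have -> : besselI N%:R y = limn (series u).
  rewrite /besselI; congr (limn (series _)); apply/funext => m.
  by rewrite -!natrD powR_mulrn// Gamma_nat.
(* As [1 / (m + N)! <= 1], the series is dominated by [(y/2)^N] times the exponential series at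
   [(y/2)^2]. Convergence is what lets the real limit be read in [\bar R]. *)
have cu : cvgn (series u).
  apply: (@series_le_cvg _ _ ((y / 2) ^+ N *: exp_coeff ((y / 2) ^+ 2))) => //.
  - by move=> m; rewrite mulr_ge0 ?divr_ge0 ?exprn_ge0.
  - move=> m; have -> : u m = (y / 2) ^+ N * (((y / 2) ^+ 2) ^+ m / m`!%:R)
        * (m + N)`!%:R^-1.
      by rewrite /u exprD exprM invfM; ring.
    rewrite ler_piMr ?mulr_ge0 ?invr_ge0 ?exprn_ge0//.
    by rewrite invf_le1 ?ltr0n ?fact_gt0// ler1n fact_gt0.
  - by apply: is_cvg_seriesZ; exact: is_cvg_series_exp_coeff.
rewrite -EFin_lim// -nneseries_esumT; last by move=> m; rewrite lee_fin; exact: u0.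
by apply: congr_lim; apply/funext => m /=; rewrite /series/= -sumEFin.
Qed.

Lemma sqrt_div_mul (a b : R) : 0 < a -> 0 < b ->
  Num.sqrt (a / b) * Num.sqrt (a * b) = a.
Proof.
move=> a0 b0; rewrite -sqrtrM ?divr_ge0 ?ltW//.
have -> : a / b * (a * b) = a ^+ 2 by field; rewrite gt_eqF.
by rewrite sqrtr_sqr gtr0_norm.
Qed.

(** The pairs of difference [N] are the [(m + N, m)], and the terms match one by one because
    [sqrt(a/b)^N * sqrt(ab)^N = a^N]. The Poisson factors [exp(-aV)] and [exp(-bV)] are left out. *)
Let skellam_nat (a b V : R) (N : nat) : 0 < a -> 0 < b -> 0 <= V ->
  (Num.sqrt (a / b) ^+ N * besselI N%:R (2 * V * Num.sqrt (a * b)))%:E =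
  \esum_(p in [set p : nat * nat | p.1%:Z - p.2%:Z = N%:Z])
    ((a * V) ^+ p.1 / p.1`!%:R * ((b * V) ^+ p.2 / p.2`!%:R))%:E.
Proof.
move=> a0 b0 V0; rewrite EFinM besselI_nat ?mulr_ge0//.
rewrite -ge0_esumZl; last 2 first.
- by rewrite lee_fin exprn_ge0.
- by move=> m; rewrite lee_fin divr_ge0 ?mulr_ge0 ?exprn_ge0// ?divr_ge0 ?mulr_ge0.
rewrite (@reindex_esum _ _ _ [set: nat] _ (fun m : nat => (m + N, m)%N)); last first.
  split=> [m _ /=|m m' _ _ [_ ->]//|[p q] /= pq]; first by lia.
  by exists q => //; congr pair; lia.
apply: eq_esum => m _; rewrite -EFinM; congr EFin => /=.
have -> : 2 * V * Num.sqrt (a * b) / 2 = V * Num.sqrt (a * b) by field.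
have -> : (V * Num.sqrt (a * b)) ^+ (2 * m + N) =
    V ^+ (2 * m + N) * ((a * b) ^+ m * Num.sqrt (a * b) ^+ N).
  by rewrite exprMn [Num.sqrt _ ^+ (_ + _)]exprD exprM sqr_sqrtr// mulr_ge0// ltW.
have rs : Num.sqrt (a / b) ^+ N * Num.sqrt (a * b) ^+ N = a ^+ N.
  by rewrite -exprMn sqrt_div_mul.
by rewrite mul2n -addnn !exprMn !exprD -rs invfM; ring.
Qed.

Lemma skellam_besselI (a b V : R) (z : int) : 0 < a -> 0 < b -> 0 <= V ->
  ((a / b) `^ (z%:~R / 2) * besselI `|z|%:~R (2 * V * Num.sqrt (a * b)))%:E =
  \esum_(p in [set p : nat * nat | p.1%:Z - p.2%:Z = z])
    ((a * V) ^+ p.1 / p.1`!%:R * ((b * V) ^+ p.2 / p.2`!%:R))%:E.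
Proof.
move=> a0 b0 V0; rewrite [z%:~R / 2]mulrC powRrM powR12_sqrt ?divr_ge0 ?ltW//.
rewrite powR_intmul ?sqrtr_ge0//.
case: z => N; first by rewrite -skellam_nat.
rewrite NegzE normrN -exprnN -exprVn -sqrtrV ?divr_ge0 ?ltW// invf_div.
rewrite [a * b]mulrC skellam_nat//.
rewrite (@reindex_esum _ _ _ [set p : nat * nat | p.1%:Z - p.2%:Z = - N.+1%:Z] _
  (fun p => (p.2, p.1))).
  by apply: eq_esum => p _ /=; rewrite mulrC.
split=> [[p q]/= pq|[p q] [p' q'] _ _ [-> ->]//|[p q] /= pq]; first by lia.
by exists (q, p) => //=; lia.
Qed.

End besselI_nat.

Lemma volume_ge0 (R : realType) (d : nat) (A : set (d.-tuple R)) : 0 <= volume A.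
Proof.
apply: fine_ge0; elim: d A => [|d ih] A //=.
by apply: integral_ge0 => x _; exact: ih.
Qed.

Section independent_fields.
Context {disp : measure_display} {T : measurableType disp} {R : realType}.
Variables (P : probability T R) (d : nat).
Implicit Types (M : set (d.-tuple R) -> {RV P >-> nat}) (A : set (d.-tuple R)).

Lemma sigma_field_preimage M A (B : set nat) : rectangle A ->
  sigma_field M (M A @^-1` B).
Proof.
move=> rA; apply: sub_sigma_algebra; exists A => //.
by exists B => //; rewrite setTI.
Qed.

Lemma measurable_preimage_pair M1 M2 A (p : nat * nat) :
  measurable ((fun w => (M1 A w, M2 A w)) @^-1` [set p]).
Proof.
rewrite [X in measurable X](_ : _ = M1 A @^-1` [set p.1] `&` M2 A @^-1` [set p.2]).
  by apply: measurableI; rewrite -[X in measurable X]setTI; exact: measurable_funP.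
by case: p => p q; apply/seteqP; split => w /= [] -> ->.
Qed.

Lemma independent_fields_sub M1 M2 A (n : int) :
  independent_fields M1 M2 -> rectangle A ->
  P [set w | (M1 A w)%:Z - (M2 A w)%:Z = n] =
  (\esum_(p in [set p : nat * nat | (p.1%:Z - p.2%:Z)%R = n])
    (P (M1 A @^-1` [set p.1]) * P (M2 A @^-1` [set p.2])))%E.
Proof.
move=> indep rA; pose D := [set p : nat * nat | (p.1%:Z - p.2%:Z)%R = n].
rewrite (measure_preimage_esum P (X := fun w => (M1 A w, M2 A w)) D); last first.
  exact: measurable_preimage_pair.
apply: eq_esum => -[p q] _ /=; rewrite -indep; last 2 first.
- exact: sigma_field_preimage.
- exact: sigma_field_preimage.
by congr (P _); apply/seteqP; split => w /= [] -> ->.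
Qed.

End independent_fields.

(* Both sides of the Skellam formula are fibered sums over the tables [u] of
   jump counts, [(u j).1] for the first field and [(u j).2] for the second. *)
Lemma esum_Theta_sub (R : realType) (k : nat) (n : int)
    (f g : 'I_k -> nat -> \bar R) :
  (forall j i, 0 <= f j i)%E -> (forall j i, 0 <= g j i)%E ->
  (\esum_(p in [set p : nat * nat | (p.1%:Z - p.2%:Z)%R = n])
     ((\esum_(v in @Theta k p.1) \prod_(j < k) f j (v j)) *
      (\esum_(v in @Theta k p.2) \prod_(j < k) g j (v j))) =
   \esum_(v in @ThetaZ k n) \prod_(j < k)
     \esum_(p in [set p : nat * nat | (p.1%:Z - p.2%:Z)%R = v j])
       (f j p.1 * g j p.2))%E.
Proof.
move=> f0 g0; pose S := {ffun 'I_k -> nat * nat}.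
pose wt (v : {ffun 'I_k -> nat}) := (\sum_(j < k) j.+1 * v j)%N.
pose dif (u : S) : {ffun 'I_k -> int} := [ffun j => (u j).1%:Z - (u j).2%:Z].
pose F (v : {ffun 'I_k -> nat}) := (\prod_(j < k) f j (v j))%E.
pose G (v : {ffun 'I_k -> nat}) := (\prod_(j < k) g j (v j))%E.
have F0 v : (0 <= F v)%E by exact: prode_ge0.
have G0 v : (0 <= G v)%E by exact: prode_ge0.
have fg0 j (p : nat * nat) : (0 <= f j p.1 * g j p.2)%E by exact: mule_ge0.
transitivity (\esum_(u in dif @^-1` @ThetaZ k n)
    \prod_(j < k) (f j (u j).1 * g j (u j).2))%E; last first.
  rewrite ge0_esum_preimage; last by move=> u; exact: prode_ge0.
  apply: eq_esum => v _.
  rewrite (prod_esum (fun j => [set p : nat * nat | (p.1%:Z - p.2%:Z)%R = v j]) fg0).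
  congr esum; apply/seteqP; split => [u /= <- j|u /= uv]; first by rewrite ffunE.
  by apply/ffunP => j; rewrite ffunE.
transitivity (\esum_(q in (fun q : _ * _ => (wt q.1, wt q.2)) @^-1`
    [set p : nat * nat | (p.1%:Z - p.2%:Z)%R = n]) (F q.1 * G q.2))%E.
  rewrite ge0_esum_preimage; last by move=> q; exact: mule_ge0.
  apply: eq_esum => -[a b] _ /=; rewrite ge0_esumM//.
  congr esum; apply/seteqP; split => [[v w] /= [va wb]|[v w] /= [va wb]].
    by congr pair.
  by split.
pose split_table (u : S) : {ffun 'I_k -> nat} * {ffun 'I_k -> nat} :=
  ([ffun j => (u j).1], [ffun j => (u j).2]).
have wt_dif u : (wt (split_table u).1)%:Z - (wt (split_table u).2)%:Z =
    \sum_(j < k) j.+1%:Z * dif u j.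
  rewrite /wt !(big_morph Posz PoszD (erefl _)) -sumrB; apply: eq_bigr => j _.
  by rewrite !ffunE !PoszM mulrBr.
rewrite (@reindex_esum _ _ _ (dif @^-1` @ThetaZ k n) _ split_table).
  apply: eq_esum => u _; rewrite /F /G -big_split /=.
  by apply: eq_bigr => j _; rewrite !ffunE.
split.
- by move=> u; rewrite /ThetaZ/= -wt_dif.
- move=> u u' _ _ [/ffunP e1 /ffunP e2]; apply/ffunP => j.
  by have := e1 j; have := e2 j; rewrite !ffunE; case: (u j) (u' j) => ? ? [? ?] /= -> ->.
- move=> [v w] /= vw; have vwE : split_table [ffun j => (v j, w j)] = (v, w).
    by congr pair; apply/ffunP => j; rewrite !ffunE.
  exists [ffun j => (v j, w j)] => //.
  by rewrite /ThetaZ /= -wt_dif vwE.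
Qed.

Theorem mainTheorem11 (disp : measure_display) (T : measurableType disp)
    (R : realType) (P : probability T R) (d k : nat)
    (lambda1 lambda2 : 'I_k -> R)
    (M1 M2 : set (d.-tuple R) -> {RV P >-> nat}) :
  (1 <= d)%N -> (1 <= k)%N ->
  (forall j, 0 < lambda1 j) -> (forall j, 0 < lambda2 j) ->
  GPRF lambda1 M1 -> GPRF lambda2 M2 -> independent_fields M1 M2 ->
  forall (n : int) (A : set (d.-tuple R)), rectangle A ->
    P [set w | (M1 A w)%:Z - (M2 A w)%:Z = n] =
    ((expR (- ((\sum_(j < k) lambda1 j + \sum_(j < k) lambda2 j) * volume A)))%:E
     * \esum_(v in @ThetaZ k n)
         (\prod_(j < k)
            ((lambda1 j / lambda2 j) `^ ((v j)%:~R / 2)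
             * besselI `|v j|%:~R
                 (2 * volume A * Num.sqrt (lambda1 j * lambda2 j))))%:E)%E.
Proof.
move=> _ _ l1 l2 [_ pmf1 _] [_ pmf2 _] indep n A rA.
have V0 := volume_ge0 A; set V := volume A in V0 *.
pose pois (l : 'I_k -> R) j (i : nat) : R :=
  (l j * V) ^+ i / i`!%:R * expR (- (l j * V)).
have lV1 j : 0 <= lambda1 j * V by rewrite mulr_ge0// ltW.
have lV2 j : 0 <= lambda2 j * V by rewrite mulr_ge0// ltW.
have pois0 l : (forall j, 0 <= l j * V) -> forall j i, (0 <= (pois l j i)%:E)%E.
  by move=> lV0 j i; rewrite lee_fin !mulr_ge0 ?invr_ge0 ?expR_ge0 ?exprn_ge0.
have bessel0 (v : {ffun 'I_k -> int}) j : 0 <= (lambda1 j / lambda2 j) `^ ((v j)%:~R / 2)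
    * besselI `|v j|%:~R (2 * V * Num.sqrt (lambda1 j * lambda2 j)).
  rewrite -lee_fin skellam_besselI//; apply: esum_ge0 => p _.
  by rewrite lee_fin !mulr_ge0 ?invr_ge0 ?exprn_ge0.
rewrite (independent_fields_sub n indep rA).
under eq_esum do rewrite pmf1// pmf2//.
transitivity (\esum_(p in [set p : nat * nat | (p.1%:Z - p.2%:Z)%R = n])
     ((\esum_(v in @Theta k p.1) \prod_(j < k) (pois lambda1 j (v j))%:E) *
      (\esum_(v in @Theta k p.2) \prod_(j < k) (pois lambda2 j (v j))%:E)))%E.
  by apply: eq_esum => p _; congr (_ * _)%E; apply: eq_esum => v _; rewrite -prodEFin.
rewrite (esum_Theta_sub n (pois0 _ lV1) (pois0 _ lV2)).
rewrite -ge0_esumZl ?lee_fin ?expR_ge0//; last first.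
  by move=> v; rewrite lee_fin prodr_ge0.
apply: eq_esum => v _.
rewrite -EFinM -big_split/= mulr_suml -sumrN.
rewrite expR_sum -big_split/= -prodEFin; apply: eq_bigr => j _.
rewrite EFinM skellam_besselI// -ge0_esumZl; last 2 first.
- by rewrite lee_fin expR_ge0.
- by move=> p; rewrite lee_fin !mulr_ge0 ?invr_ge0 ?exprn_ge0.
apply: eq_esum => p _; rewrite -!EFinM /pois mulrDl opprD expRD; congr EFin; ring.
Qed.
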